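(* Let $\mathcal{B}=\{u_1,\dots,u_N\}$ be an orthonormal basis of $\mathbb{K}^N$, with associated unitary matrix $U$, and let $X$ be a Banach space over $\mathbb{K}$. Let $p,q,r\in[1,\infty]$, with $p',q'$ the conjugate exponents of $p,q$. Then for all $s,t,w\in[1,\infty]$ such that $$\frac1s+\frac1t+\frac1w=1,$$ and all $\alpha\in\mathbb{K}^N$, $f\in X^N$, $$\|\alpha*f\|_r\le\|U^*\|_{s,r}\,\|U\|_{p',t}\,\|U\|_{q',w}\,\|\alpha\|_p\,\|f\|_q .$$ Consequently, $*:L^p(V,\mathbb{K})\times L^q(V,X)\to L^r(V,X)$ is a continuous bilinear operator, and $$\|*\|\le\min\left\{\|U^*\|_{s,r}\|U\|_{p',t}\|U\|_{q',w}\ \middle|\ s,t,w\in[1,\infty],\ \frac1s+\frac1t+\frac1w=1\right\}.$$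
   Context: $\mathbb{K}$ is $\mathbb{R}$ or $\mathbb{C}$, $N\ge1$, $V=\{1,\dots,N\}$. Elements of $X^N$ are viewed as functions $f:V\to X$ (signals). Norms: $\|f\|_p=\left(\sum_{n=1}^N\|f(n)\|^p\right)^{1/p}$ for $p\in[1,\infty)$ and $\|f\|_\infty=\max_n\|f(n)\|$; $L^p(V,X)$ denotes $X^N$ with $\|\cdot\|_p$, and $L^p(V,\mathbb{K})$ is the case $X=\mathbb{K}$. $U$ is the unitary matrix whose $k$-th column is $u_k=(u_k(1),\dots,u_k(N))$; its $n$-th row is $u(n)=(u_1(n),\dots,u_N(n))$; $U^*$ is its conjugate transpose. Graph Fourier transform: $\hat f(k)=\sum_{n=1}^N\overline{u_k(n)}f(n)$ for $f\in X^N$, and likewise for $\alpha\in\mathbb{K}^N$. Convolution: $(\alpha*f)(n)=\sum_{k=1}^N u_k(n)\hat\alpha(k)\hat f(k)$ for $\alpha\in\mathbb{K}^N$, $f\in X^N$. Mixed norms: for $a,b\in[1,\infty]$, $\|U\|_{a,b}=\left(\sum_{k=1}^N\left(\sum_{n=1}^N|u_k(n)|^a\right)^{b/a}\right)^{1/b}$, i.e. the $\ell^b$ norm over $k$ of the $\ell^a$ norms of the columns $u_k$, with the usual modifications (maxima) when $a=\infty$ or $b=\infty$; hence $\|U^*\|_{a,b}$ is the $\ell^b$ norm over $n$ of the $\ell^a$ norms of the rows $u(n)$. Conjugate exponents satisfy $1/p+1/p'=1$, with $1/\infty=0$. $\|*\|$ is the norm of the bilinear operator, i.e. the least $C\ge0$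 with $\|\alpha*f\|_r\le C\|\alpha\|_p\|f\|_q$ for all $\alpha,f$. *)

(* Defs.v *)
From HB Require Import structures.
From mathcomp Require Import all_boot all_order all_algebra.
From mathcomp Require Import sesquilinear complex.
From mathcomp Require Import all_classical all_reals all_analysis.

Set Implicit Arguments.
Unset Strict Implicit.
Unset Printing Implicit Defensive.

Import Order.TTheory GRing.Theory Num.Theory.
Import numFieldNormedType.Exports.

Local Open Scope classical_set_scope.
Local Open Scope ring_scope.

Variant scalar_kind := RealScalars | ComplexScalars.

Definition scalar_field (R : realType) (k : scalar_kind) : numFieldType :=
  match k with
  | RealScalars => R
  | ComplexScalars => R[i]%C
  end.

Definition conj_scalar (R : realType) (k : scalar_kind) :
    scalar_field R k -> scalar_field R k :=
  match k with
  | RealScalars => id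
  | ComplexScalars => @conjc R
  end.

Definition re_scalar (R : realType) (k : scalar_kind) : scalar_field R k -> R :=
  match k with
  | RealScalars => id
  | ComplexScalars => @complex.Re R
  end.

(* The library norm of a normed space over K takes its values in K; for       *)
(* K = R[i] these values are nonnegative reals, so taking real parts loses    *)
(* nothing.                                                                   *)
Definition real_norm (R : realType) (k : scalar_kind)
    (X : normedZmodType (scalar_field R k)) (x : X) : R :=
  re_scalar `|x|.

(* Exponents are only meant to range over [1, +oo]; the value at -oo is junk. *)
(* All maximised terms are nonnegative, so 0 is a harmless base value.        *)
Definition lp_norm (R : realType) (N : nat) (p : \bar R) (x : 'I_N -> R) : R :=
  match p with
  | p%:E => (\sum_(n < N) `|x n| `^ p) `^ p^-1
  | +oo%E => \big[Order.max/0]_(n < N) `|x n|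
  | -oo%E => 0
  end.

Definition signal_norm (R : realType) (k : scalar_kind) (N : nat)
    (X : normedZmodType (scalar_field R k)) (p : \bar R) (f : 'I_N -> X) : R :=
  lp_norm p (fun n => real_norm (f n)).

Definition mixed_norm (R : realType) (k : scalar_kind) (N : nat)
    (U : 'M[scalar_field R k]_N) (a b : \bar R) : R :=
  lp_norm b (fun j => lp_norm a (fun n => real_norm (U n j))).

Definition conj_transpose (R : realType) (k : scalar_kind) (N : nat)
    (U : 'M[scalar_field R k]_N) : 'M[scalar_field R k]_N :=
  map_mx (@conj_scalar R k) U^T.

Definition orthonormal_basis (R : realType) (k : scalar_kind) (N : nat)
    (u : 'I_N -> 'cV[scalar_field R k]_N) : Prop :=
  basis_of fullv (codom u) /\
  forall i j, \sum_(n < N) u i n 0 * conj_scalar (u j n 0) = (i == j)%:R.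

Definition basis_matrix (R : realType) (k : scalar_kind) (N : nat)
    (u : 'I_N -> 'cV[scalar_field R k]_N) : 'M[scalar_field R k]_N :=
  \matrix_(n < N, j < N) u j n 0.

Definition gft (R : realType) (k : scalar_kind) (N : nat)
    (U : 'M[scalar_field R k]_N) (X : lmodType (scalar_field R k)) (f : 'I_N -> X) :
    'I_N -> X :=
  fun j => \sum_(n < N) conj_scalar (U n j) *: f n.

Definition graph_conv (R : realType) (k : scalar_kind) (N : nat)
    (U : 'M[scalar_field R k]_N) (X : lmodType (scalar_field R k))
    (alpha : 'I_N -> (scalar_field R k)^o) (f : 'I_N -> X) : 'I_N -> X :=
  fun n => \sum_(j < N) (U n j * gft U alpha j) *: gft U f j.

(* Joint continuity of B : L^p(V,K) x L^q(V,X) -> L^r(V,X).                   *)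
Definition lp_continuous (R : realType) (k : scalar_kind) (N : nat)
    (X : normedModType (scalar_field R k)) (p q r : \bar R)
    (B : ('I_N -> (scalar_field R k)^o) -> ('I_N -> X) -> 'I_N -> X) : Prop :=
  forall alpha f (e : R), 0 < e -> exists2 d : R, 0 < d &
    forall beta g,
      signal_norm p (beta - alpha) < d -> signal_norm q (g - f) < d ->
      signal_norm r (B beta g - B alpha f) < e.

Definition bilinear_bounds (R : realType) (k : scalar_kind) (N : nat)
    (X : normedModType (scalar_field R k)) (p q r : \bar R)
    (B : ('I_N -> (scalar_field R k)^o) -> ('I_N -> X) -> 'I_N -> X) : set R :=
  [set C | 0 <= C /\ forall alpha f,
    signal_norm r (B alpha f) <= C * signal_norm p alpha * signal_norm q f].

Definition is_least (R : realType) (A : set R) (m : R) : Prop :=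
  A m /\ lbound A m.

Definition admissible (R : realType) (s t w : \bar R) : Prop :=
  [/\ (1 <= s)%E, (1 <= t)%E, (1 <= w)%E & (s^-1 + t^-1 + w^-1 = 1)%E].

(* Main.v *)
Require Import Defs.
From HB Require Import structures.
From mathcomp Require Import all_boot all_order all_algebra.
From mathcomp Require Import sesquilinear complex.
From mathcomp Require Import all_classical all_reals all_analysis.
From mathcomp Require Import ring lra.

(** The estimate is three applications of Hoelder's inequality. At a vertex n
    the convolution is a sum over the frequencies j of three factors, U n j, the
    Fourier coefficient of alpha and that of f; Hoelder with the exponents
    s, t, w ([hoelder3]) bounds it by the l^s norm of the n-th row of U times the
    l^t norm of the transform of alpha times the l^w norm of the transform of f
    ([graph_conv_pointwise]). Each Fourier coefficient is in turn a pairing with a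
    column of U, so Hoelder with p, p' (or q, q') bounds it by the l^p' norm of
    that column times the norm of the signal ([gft_bound]). Taking l^t, l^w and
    l^r norms, which are monotone and homogeneous, assembles the mixed norms of
    U and of its conjugate transpose ([graph_conv_bound]).

    A bounded bilinear operator is continuous ([bounded_bilinear_continuous])
    and its set of bounds contains its infimum ([bilinear_bounds_least]), which
    is the operator norm.

    The minimum over the admissible triples is attained by compactness: as a
    function of the inverse exponents 1/s, 1/t, 1/w, which range over the standard
    simplex, the product of mixed norms is continuous, including at the faces
    where an exponent is infinite ([continuous_lp_norm_exponent],
    [mixed_norm_min]). The operator norm is below this minimum because the
    minimum is itself one of the bounds. *)

Set Implicit Arguments.
Unset Strict Implicit.
Unset Printing Implicit Defensive.

Import Order.TTheory GRing.Theory Num.Theory.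
Import numFieldNormedType.Exports.

Local Open Scope classical_set_scope.
Local Open Scope ring_scope.

(** * The real-valued norm on scalars and vectors *)

Section RealNorm.
Variables (R : realType) (k : scalar_kind).
Implicit Type X : normedZmodType (scalar_field R k).

Lemma re_scalar_le (a b : scalar_field R k) : a <= b -> re_scalar a <= re_scalar b.
Proof. by case: k a b => //= a b; rewrite lecE => /andP[]. Qed.

Lemma re_scalarD (a b : scalar_field R k) :
  re_scalar (a + b) = re_scalar a + re_scalar b.
Proof. by case: k a b => //= -[? ?] [? ?]. Qed.

Lemma re_scalar0 : re_scalar (0 : scalar_field R k) = 0.
Proof. by case: k. Qed.

Lemma re_scalarM_ge0 (a b : scalar_field R k) : 0 <= a ->
  re_scalar (a * b) = re_scalar a * re_scalar b.
Proof.
case: k a b => //= -[a a'] [b b']; rewrite lecE => /andP[/eqP/= -> _].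
by rewrite mul0r subr0.
Qed.

Lemma real_norm_ge0 X (x : X) : 0 <= real_norm x.
Proof. by rewrite -re_scalar0 re_scalar_le. Qed.

Lemma ler_real_normD X (x y : X) : real_norm (x + y) <= real_norm x + real_norm y.
Proof. by rewrite -re_scalarD re_scalar_le// ler_normD. Qed.

Lemma real_norm0 X : real_norm (0 : X) = 0.
Proof. by rewrite /real_norm normr0 re_scalar0. Qed.

Lemma ler_real_norm_sum X (I : finType) (F : I -> X) :
  real_norm (\sum_i F i) <= \sum_i real_norm (F i).
Proof.
elim/big_ind2: _ => [|a x b y xa yb|//]; first by rewrite real_norm0.
by rewrite (le_trans (ler_real_normD _ _))// lerD.
Qed.

Lemma real_normZ (X : normedModType (scalar_field R k)) (c : scalar_field R k)
  (x : X) : real_norm (c *: x) = real_norm c * real_norm x.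
Proof. by rewrite /real_norm normrZ re_scalarM_ge0. Qed.

Lemma real_normM (c d : scalar_field R k) :
  real_norm (c * d) = real_norm c * real_norm d.
Proof. by rewrite /real_norm normrM re_scalarM_ge0. Qed.

Lemma real_norm_conj (c : scalar_field R k) : real_norm (conj_scalar c) = real_norm c.
Proof. by case: k c => //= c; exact: (congr1 (@complex.Re R) (normcJ c)). Qed.

End RealNorm.

(** * Norms of finite families of reals *)

Lemma powRK (R : realType) (x p : R) : 0 <= x -> 0 < p -> (x `^ p) `^ p^-1 = x.
Proof. by move=> x0 p0; rewrite -powRrM mulfV ?gt_eqF// powRr1. Qed.

Section LpNorm.
Variables (R : realType) (N : nat).
Implicit Types (p : \bar R) (x y : 'I_N -> R).

Lemma sum_powR_ge0 (r : R) x : 0 <= \sum_n `|x n| `^ r.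
Proof. by rewrite sumr_ge0// => n _; exact: powR_ge0. Qed.

Lemma lp_norm_ge0 p x : 0 <= lp_norm p x.
Proof. by case: p => [p| |] //=; [exact: powR_ge0|exact: bigmax_ge_id]. Qed.

Lemma ler_lp_norm p x y : (0 < p)%E -> (forall n, `|x n| <= `|y n|) ->
  lp_norm p x <= lp_norm p y.
Proof.
case: p => [p| |] /= p0 xy; [|
  apply: bigmax_le => [|i _]; [exact: bigmax_ge_id|];
  exact: le_trans (xy i) (le_bigmax _ _ i)|by rewrite ltNge leNye in p0].
rewrite lte_fin in p0.
apply: ge0_ler_powR; rewrite ?nnegrE ?sum_powR_ge0 ?invr_ge0 ?(ltW p0)//.
by apply: ler_sum => i _; rewrite ge0_ler_powR ?nnegrE// ltW.
Qed.

Lemma lp_normZ p c x : (0 < p)%E -> lp_norm p (fun n => c * x n) = `|c| * lp_norm p x.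
Proof.
case: p => [p| |] //= p0.
  rewrite lte_fin in p0.
  under eq_bigr => i _ do rewrite normrM powRM//.
  by rewrite -mulr_sumr powRM ?sum_powR_ge0 ?powR_ge0// -powRrM mulfV ?gt_eqF// powRr1.
under eq_bigr => i _ do rewrite normrM.
elim/big_ind2: _ => [|a b a' b' -> ->|//]; first by rewrite mulr0.
by rewrite maxr_pMr.
Qed.

Lemma ler_norm_lp_norm p x n : (0 < p)%E -> `|x n| <= lp_norm p x.
Proof.
case: p => [p| |] //= p0; last exact: le_bigmax.
rewrite lte_fin in p0.
have {1}-> : `|x n| = (`|x n| `^ p) `^ p^-1 by rewrite powRK.
apply: ge0_ler_powR; rewrite ?nnegrE ?sum_powR_ge0 ?invr_ge0 ?powR_ge0 ?(ltW p0)//.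
by rewrite (bigD1 n)//= lerDl sumr_ge0// => i _; exact: powR_ge0.
Qed.

(** With [ler_norm_lp_norm], this makes all the l^p norms equivalent to the
    maximum norm. It serves both as a substitute for Minkowski's inequality and
    to control l^p as p tends to infinity, since the constant then tends to 1. *)
Lemma lp_norm_le_max p x M : (0 < p)%E -> 0 <= M -> (forall n, `|x n| <= M) ->
  lp_norm p x <= N%:R `^ fine p^-1 * M.
Proof.
case: p => [p| |] //= p0 M0 xM; last first.
  by rewrite powRr0 mul1r; apply: bigmax_le.
rewrite lte_fin in p0.
rewrite inver gt_eqF//=.
have {1}-> : M = (M `^ p) `^ p^-1 by rewrite powRK.
rewrite -powRM ?powR_ge0//.
apply: ge0_ler_powR; rewrite ?nnegrE ?sum_powR_ge0 ?invr_ge0 ?mulr_ge0 ?powR_ge0 ?(ltW p0)//.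
rewrite mulr_natl -[X in _ *+ X](card_ord N) -sumr_const.
by apply: ler_sum => i _; rewrite ge0_ler_powR ?nnegrE// ltW.
Qed.

(** Up to the factor [lp_norm p x], every family is dominated by the 1/p-th
    power of a subprobability vector, namely the normalised `|x n| `^ p. For
    p = +oo the power is the 0-th one, which is constantly 1 even at 0, so any
    subprobability vector works. In this form Hoelder's inequality treats
    finite and infinite exponents, and families of norm 0, alike. *)
Lemma lp_norm_certificate p x : (0 < p)%E ->
  exists E : 'I_N -> R, [/\ forall n, 0 <= E n, \sum_n E n <= 1 &
    forall n, `|x n| <= lp_norm p x * E n `^ fine p^-1].
Proof.
case: p => [p| |] //= p0; last first.
  exists (fun=> 0); split => [//||n]; first by rewrite big1.
  by rewrite powRr0 mulr1 le_bigmax.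
rewrite lte_fin in p0.
rewrite inver gt_eqF//=.
set S := \sum_n `|x n| `^ p.
have S0 : 0 <= S by exact: sum_powR_ge0.
exists (fun n => `|x n| `^ p / S); split => [n||n].
- by rewrite divr_ge0// powR_ge0.
- rewrite -mulr_suml -/S.
  by have [->|S_neq0] := eqVneq S 0; [rewrite mul0r|rewrite mulfV].
- have [SE|S_neq0] := eqVneq S 0.
    have : `|x n| `^ p == 0.
      by move/eqP: SE; rewrite psumr_eq0// => /allP/(_ n); apply; rewrite mem_index_enum.
    rewrite powR_eq0 => /andP[/eqP -> _].
    by rewrite mulr_ge0// powR_ge0.
  rewrite -powRM ?divr_ge0 ?powR_ge0// mulrC divfK//.
  by rewrite powRK.
Qed.

End LpNorm.

(** * Weighted arithmetic-geometric means and Hoelder's inequality *)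

(** This is the a-th power of x <= m * expR (x / m - 1), which says that expR
    lies above its tangent at 0. *)
Lemma powR_le_tangent (R : realType) (a x m : R) : 0 <= a -> 0 <= x -> 0 < m ->
  x `^ a <= m `^ a * expR (a * (x / m - 1)).
Proof.
move=> a0 x0 m0.
have xm : x <= m * expR (x / m - 1).
  by rewrite mulrC -ler_pdivrMr// -[leLHS](subrK 1) addrC expR_ge1Dx.
rewrite [a * _]mulrC expRM -powRM ?expR_ge0 ?(ltW m0)//.
by apply: ge0_ler_powR; rewrite ?nnegrE// mulr_ge0 ?expR_ge0 ?ltW.
Qed.

(** Take m to be the weighted arithmetic mean in the tangent bound: in the
    product of the three bounds the exponents add up to m / m - 1 = 0, and what
    remains is m `^ (a + b + c) = m. Zero weights are allowed, which is what
    infinite exponents require. *)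
Lemma weighted_amgm3 (R : realType) (a b c x y z : R) :
  0 <= a -> 0 <= b -> 0 <= c -> a + b + c = 1 ->
  0 <= x -> 0 <= y -> 0 <= z ->
  x `^ a * y `^ b * z `^ c <= a * x + b * y + c * z.
Proof.
move=> a0 b0 c0 abc x0 y0 z0; set m := (leRHS).
have ax0 : 0 <= a * x by exact: mulr_ge0.
have by0 : 0 <= b * y by exact: mulr_ge0.
have cz0 : 0 <= c * z by exact: mulr_ge0.
have m_ge0 : 0 <= m by rewrite !addr_ge0.
have pow0 (d t : R) : 0 < d -> d * t = 0 -> t `^ d = 0.
  by move=> d0 /eqP; rewrite mulf_eq0 gt_eqF//= => /eqP ->; rewrite powR0// gt_eqF.
(* If m = 0, the factor with a positive weight vanishes. *)
have [m0|m_neq0] := eqVneq m 0.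
  have [ax [by' cz]] : a * x = 0 /\ b * y = 0 /\ c * z = 0.
    by rewrite /m in m0; repeat split; lra.
  have [a_gt0|] := ltP 0 a; first by rewrite (pow0 _ _ a_gt0 ax) !mul0r.
  have [b_gt0|] := ltP 0 b; first by rewrite (pow0 _ _ b_gt0 by') mulr0 mul0r.
  by move=> b_le0 a_le0; rewrite (pow0 c)// ?mulr0//; lra.
have m_gt0 : 0 < m by rewrite lt_neqAle eq_sym m_neq0.
apply: (@le_trans _ _ ((m `^ a * expR (a * (x / m - 1))) *
  (m `^ b * expR (b * (y / m - 1))) * (m `^ c * expR (c * (z / m - 1))))).
  by rewrite !ler_pM ?mulr_ge0 ?powR_ge0// powR_le_tangent.
have -> : (m `^ a * expR (a * (x / m - 1))) *
  (m `^ b * expR (b * (y / m - 1))) * (m `^ c * expR (c * (z / m - 1))) =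
  (m `^ a * m `^ b * m `^ c) *
  (expR (a * (x / m - 1)) * expR (b * (y / m - 1)) * expR (c * (z / m - 1))) by ring.
rewrite -!expRD -!powRD ?m_neq0 ?implybT// abc powRr1//.
have -> : a * (x / m - 1) + b * (y / m - 1) + c * (z / m - 1) =
          m / m - (a + b + c) by rewrite {4}/m; field.
by rewrite abc mulfV// subrr expR0 mulr1.
Qed.

Lemma fine_inv_ge0 (R : realType) (p : \bar R) : (0 < p)%E -> 0 <= fine p^-1.
Proof. by move=> p0; rewrite fine_ge0// inve_ge0 ltW. Qed.

Lemma inv_fineK (R : realType) (p : \bar R) : (0 < p)%E -> (fine p^-1)%:E = (p^-1)%E.
Proof. by move=> p0; rewrite fineK// fin_numV ?gt_eqF// (lt_trans _ p0). Qed.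

(** The factors are replaced by their certificates, to which the weighted
    arithmetic-geometric mean inequality applies with weights 1/s, 1/t, 1/w; the
    sum of the means is at most the sum of the weights, which is 1. *)
Lemma hoelder3 (R : realType) (N : nat) (s t w : \bar R) (x y z : 'I_N -> R) :
  (0 < s)%E -> (0 < t)%E -> (0 < w)%E -> (s^-1 + t^-1 + w^-1 = 1)%E ->
  \sum_n `|x n| * `|y n| * `|z n| <= lp_norm s x * lp_norm t y * lp_norm w z.
Proof.
move=> s0 t0 w0 stw.
have [E [E0 E1 xE]] := lp_norm_certificate x s0.
have [F [F0 F1 yF]] := lp_norm_certificate y t0.
have [G [G0 G1 zG]] := lp_norm_certificate z w0.
have := fine_inv_ge0 s0; have := fine_inv_ge0 t0; have := fine_inv_ge0 w0.
rewrite -(inv_fineK s0) -(inv_fineK t0) -(inv_fineK w0) -!EFinD in stw.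
move: stw xE yF zG => -[].
move: (fine _) (fine _) (fine _) => c b a abc xE yF zG c0 b0 a0.
set A := lp_norm s x in xE *; set B := lp_norm t y in yF *.
set C := lp_norm w z in zG *.
have ABC0 : 0 <= A * B * C by rewrite !mulr_ge0 ?lp_norm_ge0.
apply: (@le_trans _ _ (\sum_n A * B * C * (a * E n + b * F n + c * G n))).
  apply: ler_sum => n _.
  apply: (@le_trans _ _ (A * E n `^ a * (B * F n `^ b) * (C * G n `^ c))).
    by rewrite !ler_pM ?mulr_ge0.
  rewrite (_ : _ * _ * _ = A * B * C * (E n `^ a * F n `^ b * G n `^ c)); last by ring.
  by rewrite ler_wpM2l// weighted_amgm3.
rewrite -mulr_sumr -[leRHS]mulr1 ler_wpM2l// !big_split/= -!mulr_sumr -abc.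
by rewrite !lerD// ler_piMr.
Qed.

(** The case of three factors, the third being 1 with exponent +oo. *)
Lemma hoelder2 (R : realType) (N : nat) (p q : \bar R) (x y : 'I_N -> R) :
  (0 < p)%E -> (0 < q)%E -> (p^-1 + q^-1 = 1)%E ->
  \sum_n `|x n| * `|y n| <= lp_norm p x * lp_norm q y.
Proof.
move=> p0 q0 pq; have pqy : (p^-1 + q^-1 + (+oo : \bar R)^-1 = 1)%E by rewrite invey adde0.
have := hoelder3 x y (fun=> 1) p0 q0 (ltry 0) pqy.
under eq_bigr do rewrite normr1 mulr1.
move=> /le_trans; apply; rewrite ler_piMr ?mulr_ge0 ?lp_norm_ge0//=.
by apply: bigmax_le => // i _; rewrite normr1.
Qed.

Lemma ler_lp_normM (R : realType) (N : nat) (p : \bar R) (c : R) (x y : 'I_N -> R) :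
  (0 < p)%E -> 0 <= c -> (forall n, 0 <= x n) -> (forall n, x n <= c * y n) ->
  lp_norm p x <= c * lp_norm p y.
Proof.
move=> p0 c0 x0 xy.
rewrite -[X in X * lp_norm _ _](ger0_norm c0) -lp_normZ//.
apply: ler_lp_norm => // n.
by rewrite ger0_norm// (le_trans (xy n))// ler_norm.
Qed.

(** * Norm estimates for the Fourier transform and the convolution *)

Lemma admissible_gt0 (R : realType) (s t w : \bar R) : admissible s t w ->
  [/\ (0 < s)%E, (0 < t)%E & (0 < w)%E].
Proof.
by case=> s1 t1 w1 _;
  split; [exact: lt_le_trans s1|exact: lt_le_trans t1|exact: lt_le_trans w1].
Qed.

Section GraphConv.
Variables (R : realType) (k : scalar_kind) (N : nat).
Variable U : 'M[scalar_field R k]_N.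

Lemma gft_bound (X : normedModType (scalar_field R k)) (p p' : \bar R)
    (f : 'I_N -> X) j :
  (0 < p)%E -> (0 < p')%E -> (p^-1 + p'^-1 = 1)%E ->
  real_norm (gft U f j) <=
    lp_norm p' (fun n => real_norm (U n j)) * signal_norm p f.
Proof.
move=> p0 p'0 pp'; apply: le_trans (ler_real_norm_sum _) _.
apply: (@le_trans _ _ (\sum_n `|real_norm (U n j)| * `|real_norm (f n)|)).
  apply: ler_sum => n _.
  by rewrite real_normZ real_norm_conj !ger0_norm// real_norm_ge0.
by apply: hoelder2 => //; rewrite addeC.
Qed.

Lemma lp_norm_gft (X : normedModType (scalar_field R k)) (p p' t : \bar R)
    (f : 'I_N -> X) :
  (0 < p)%E -> (0 < p')%E -> (p^-1 + p'^-1 = 1)%E -> (0 < t)%E ->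
  signal_norm t (gft U f) <= mixed_norm U p' t * signal_norm p f.
Proof.
move=> p0 p'0 pp' t0; rewrite mulrC; apply: ler_lp_normM => //.
- exact: lp_norm_ge0.
- by move=> n; exact: real_norm_ge0.
- by move=> j; rewrite mulrC; exact: gft_bound.
Qed.

Lemma graph_conv_pointwise (X : normedModType (scalar_field R k)) (s t w : \bar R)
    (alpha : 'I_N -> (scalar_field R k)^o) (f : 'I_N -> X) n :
  (0 < s)%E -> (0 < t)%E -> (0 < w)%E -> (s^-1 + t^-1 + w^-1 = 1)%E ->
  real_norm (graph_conv U alpha f n) <=
    lp_norm s (fun j => real_norm (U n j)) *
    signal_norm t (gft U alpha) * signal_norm w (gft U f).
Proof.
move=> s0 t0 w0 stw; apply: le_trans (ler_real_norm_sum _) _.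
apply: le_trans (hoelder3 _ _ _ s0 t0 w0 stw); apply: ler_sum => j _.
by rewrite real_normZ real_normM !ger0_norm// real_norm_ge0.
Qed.

Lemma mixed_norm_conj_transpose (a b : \bar R) :
  mixed_norm (conj_transpose U) a b =
  lp_norm b (fun n => lp_norm a (fun j => real_norm (U n j))).
Proof.
rewrite /mixed_norm; congr (lp_norm b _); apply/funext => n.
by congr (lp_norm a _); apply/funext => j; rewrite !mxE real_norm_conj.
Qed.

(** The rows of U give the factor with exponents s and r: taking the l^r norm
    over the vertices of the pointwise bound leaves the two transforms as
    constants, and each of these is bounded by a mixed norm over the columns. *)
Lemma graph_conv_bound (X : normedModType (scalar_field R k))
    (p q r p' q' s t w : \bar R)
    (alpha : 'I_N -> (scalar_field R k)^o) (f : 'I_N -> X) :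
  (0 < p)%E -> (0 < q)%E -> (0 < r)%E -> (0 < p')%E -> (0 < q')%E ->
  (p^-1 + p'^-1 = 1)%E -> (q^-1 + q'^-1 = 1)%E -> admissible s t w ->
  signal_norm r (graph_conv U alpha f) <=
    mixed_norm (conj_transpose U) s r * mixed_norm U p' t * mixed_norm U q' w *
    signal_norm p alpha * signal_norm q f.
Proof.
move=> p0 q0 r0 p'0 q'0 pp' qq' stwP.
have [s0 t0 w0] := admissible_gt0 stwP; have [_ _ _ stw] := stwP.
have row_bound : signal_norm r (graph_conv U alpha f) <=
  signal_norm t (gft U alpha) * signal_norm w (gft U f) *
  mixed_norm (conj_transpose U) s r.
  rewrite mixed_norm_conj_transpose; apply: ler_lp_normM => //.
  - by rewrite mulr_ge0 ?lp_norm_ge0.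
  - by move=> n; exact: real_norm_ge0.
  - by move=> n; rewrite mulrC mulrA; exact: graph_conv_pointwise.
apply: le_trans row_bound _.
rewrite [leRHS](_ : _ = (mixed_norm U p' t * signal_norm p alpha) *
  (mixed_norm U q' w * signal_norm q f) * mixed_norm (conj_transpose U) s r);
  last by ring.
by rewrite ler_wpM2r ?lp_norm_ge0// ler_pM ?lp_norm_ge0// lp_norm_gft.
Qed.

Lemma gft_linear (X : lmodType (scalar_field R k)) (a : scalar_field R k)
  (f g : 'I_N -> X) j : gft U (a *: f + g) j = a *: gft U f j + gft U g j.
Proof.
rewrite /gft scaler_sumr -big_split/=; apply: eq_bigr => n _.
by rewrite scalerDr !scalerA [in LHS]mulrC.
Qed.

Lemma graph_conv_bilinear (X : lmodType (scalar_field R k)) :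
  bilinear_for *:%R *:%R (@graph_conv R k N U X).
Proof.
split=> [f a alpha beta|alpha a f g]; apply/funext => n;
  rewrite /graph_conv [in RHS]/+%R/= [in RHS]/*:%R/= scaler_sumr -big_split/=;
  apply: eq_bigr => j _; rewrite gft_linear.
  by rewrite mulrDr scalerDl scalerA; congr (_ *: _ + _); rewrite mulrCA.
by rewrite scalerDr !scalerA [in LHS]mulrC.
Qed.

End GraphConv.

(** * Bounded bilinear operators between spaces of signals *)

Section BoundedBilinear.
Variables (R : realType) (k : scalar_kind) (N : nat).
Variables (X : normedModType (scalar_field R k)) (p q r : \bar R).
Variable B : ('I_N -> (scalar_field R k)^o) -> ('I_N -> X) -> 'I_N -> X.

(** The triangle inequality up to a constant, by comparison with the maximum
    norm; this is enough for continuity. *)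
Lemma signal_norm_quasi_triangle (Y : normedZmodType (scalar_field R k))
    (s : \bar R) (f g : 'I_N -> Y) : (0 < s)%E ->
  signal_norm s (f + g) <=
    N%:R `^ fine s^-1 * (signal_norm s f + signal_norm s g).
Proof.
move=> s0; apply: lp_norm_le_max => //.
  by rewrite addr_ge0 ?lp_norm_ge0.
move=> n; rewrite ger0_norm ?real_norm_ge0//.
apply: le_trans (ler_real_normD _ _) _.
have coord_le (h : 'I_N -> Y) : real_norm (h n) <= signal_norm s h.
  have := ler_norm_lp_norm (fun n => real_norm (h n)) n s0.
  by rewrite ger0_norm ?real_norm_ge0.
by apply: lerD; exact: coord_le.
Qed.

(** The difference of values is B (beta - alpha) g + B alpha (g - f), where the
    norm of g is controlled by that of f and its distance to f. *)
Lemma bounded_bilinear_continuous (C : R) :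
  (0 < q)%E -> (0 < r)%E ->
  bilinear_for *:%R *:%R B -> bilinear_bounds p q r B C -> lp_continuous p q r B.
Proof.
move=> q0 r0 [Bl Br] [C0 BC] alpha f e e0.
set Kr : R := N%:R `^ fine r^-1; set Kq : R := N%:R `^ fine q^-1.
have Kr0 : 0 <= Kr by exact: powR_ge0.
have Kq0 : 0 <= Kq by exact: powR_ge0.
set A := signal_norm p alpha; set F := signal_norm q f.
have A0 : 0 <= A by exact: lp_norm_ge0.
have F0 : 0 <= F by exact: lp_norm_ge0.
(* When both distances are below d <= 1, the difference is at most d * M. *)
set M := Kr * (C * (Kq * (1 + F) + A)).
have M0 : 0 <= M by rewrite !(mulr_ge0, addr_ge0).
exists (Num.min 1 (e / (M + 1))).
  by rewrite lt_min ltr01 divr_gt0// ltr_wpDl.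
move=> beta g; set d := Num.min _ _ => bd gd.
have d1 : d <= 1 by rewrite ge_min lexx.
have dM : d * (M + 1) <= e by rewrite -ler_pdivlMr ?ltr_wpDl// ge_min lexx orbT.
have b0 : 0 <= signal_norm p (beta - alpha) by exact: lp_norm_ge0.
have g0 : 0 <= signal_norm q (g - f) by exact: lp_norm_ge0.
have -> : B beta g - B alpha f = B (beta - alpha) g + B alpha (g - f).
  have -> : beta - alpha = (-1) *: alpha + beta by rewrite scaleN1r addrC.
  have -> : g - f = (-1) *: f + g by rewrite scaleN1r addrC.
  by rewrite Br (Bl g (-1) alpha beta)/= !scaleN1r [RHS]addrC addrA addrK addrC.
have gq : signal_norm q g <= Kq * (1 + F).
  rewrite -[g in leLHS](subrK f); apply: le_trans (signal_norm_quasi_triangle _ _ q0) _.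
  by rewrite ler_wpM2l// lerD2r (le_trans (ltW gd)).
apply: le_lt_trans (signal_norm_quasi_triangle _ _ r0) _.
apply: (@le_lt_trans _ _ (d * M)).
  rewrite /M mulrCA ler_wpM2l// mulrCA [d * _]mulrDr mulrDr lerD//.
    by apply: le_trans (BC _ _) _; rewrite -mulrA ler_wpM2l// ler_pM ?lp_norm_ge0// ltW.
  apply: le_trans (BC _ _) _; rewrite -mulrA ler_wpM2l// mulrC ler_wpM2r// ltW//.
apply: lt_le_trans dM; rewrite mulrDr mulr1 ltrDl.
by rewrite (le_lt_trans b0 bd).
Qed.

(** A common lower bound of the admissible constants is still a bound: when
    neither signal has norm 0, the ratio of norms at a given pair of signals is a
    lower bound of all the constants, hence of the infimum. *)
Lemma bilinear_bounds_least :
  bilinear_bounds p q r B !=set0 ->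
  is_least (bilinear_bounds p q r B) (inf (bilinear_bounds p q r B)).
Proof.
move=> [C BC].
have lb0 : lbound (bilinear_bounds p q r B) 0 by move=> D [].
have hlb : has_lbound (bilinear_bounds p q r B) by exists 0.
split; last exact: ge_inf.
split; first by apply: lb_le_inf => //; exists C.
move=> alpha f; rewrite -mulrA.
have ab0 : 0 <= signal_norm p alpha * signal_norm q f.
  by rewrite mulr_ge0 ?lp_norm_ge0.
(* If one of the signals has norm 0, any bound shows that B vanishes there. *)
have [ab|ab_neq0] := eqVneq (signal_norm p alpha * signal_norm q f) 0.
  by rewrite ab mulr0 -(mulr0 C) -ab mulrA; exact: BC.2.
have ab_gt0 : 0 < signal_norm p alpha * signal_norm q f.
  by rewrite lt_neqAle eq_sym ab_neq0.
rewrite -ler_pdivrMr//; apply: lb_le_inf; first by exists C.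
by move=> D [_ BD]; rewrite ler_pdivrMr// mulrA.
Qed.

End BoundedBilinear.

(** * Continuity of the norms in the vector and in the exponent *)

Section Continuity.
Variable R : realType.

(** Away from 0 the function is expR (p * ln `|y|); at 0 it is continuous because
    `|y| `^ p < e as soon as `|y| < e `^ p^-1. *)
Lemma continuous_norm_powR (p : R) : 0 < p -> continuous (fun y : R => `|y| `^ p).
Proof.
move=> p0 y0; have [->|y0_neq0] := eqVneq y0 0.
  rewrite /continuous_at normr0 powR0 ?gt_eqF//.
  apply/cvgr0Pnorm_lt => e e0.
  have d0 : 0 < e `^ p^-1 by exact: powR_gt0.
  have := pseudometric_normed_Zmodule.nbhs0_lt (V := R) d0.
  apply: filterS => y yd.
  rewrite ger0_norm ?powR_ge0//.
  have -> : e = (e `^ p^-1) `^ p by rewrite -powRrM mulVf ?gt_eqF// powRr1// ltW.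
  by apply: gt0_ltr_powR; rewrite ?nnegrE ?powR_ge0.
have cF : {for y0, continuous (fun y : R => expR (p * ln `|y|))}.
  apply: (@continuous_cvg _ _ _ _ _ (fun y : R => p * ln `|y|) (@expR R)).
    exact: continuous_expR.
  apply: cvgM; first exact: cvg_cst.
  apply: (@continuous_cvg _ _ _ _ _ (fun y : R => `|y|) (@ln R)).
    by apply: continuous_ln; rewrite normr_gt0.
  exact: norm_continuous.
rewrite /continuous_at [X in _ --> X](_ : _ = expR (p * ln `|y0|)); last first.
  by rewrite /powR normr_eq0 (negbTE y0_neq0).
apply: cvg_trans cF; apply: near_eq_cvg.
have : \forall y \near y0, y != 0
  by exact: (@cvgr_neq0 R R R (nbhs y0) _ id y0 (@cvg_id _ _) y0_neq0).
by apply: filterS => y y_neq0; rewrite /powR normr_eq0 (negbTE y_neq0).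
Qed.

Lemma cvg_lp_norm (N : nat) (T : Type) (Z : set_system T) (FZ : Filter Z)
    (p : \bar R) (F : 'I_N -> T -> R) (L : 'I_N -> R) : (0 < p)%E ->
  (forall n, F n t @[t --> Z] --> L n) ->
  lp_norm p (F ^~ t) @[t --> Z] --> lp_norm p L.
Proof.
case: p => [p| |] /= p0 FL; [|
  by apply: (cvg_big max_continuous) => n _; exact: cvg_norm|
  by rewrite ltNge leNye in p0].
rewrite lte_fin in p0.
have lpE (y : 'I_N -> R) : (\sum_n `|y n| `^ p) `^ p^-1 =
    `|\sum_n `|y n| `^ p| `^ p^-1 by rewrite ger0_norm// sum_powR_ge0.
rewrite lpE; under eq_fun do rewrite lpE.
apply: (@continuous_cvg T R R Z FZ (fun t => \sum_n `|F n t| `^ p)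
  (fun y => `|y| `^ p^-1)).
  by apply: continuous_norm_powR; rewrite invr_gt0.
apply: (cvg_big add_continuous) => n _.
exact: (@continuous_cvg T R R Z FZ (F n) (fun y => `|y| `^ p) _
  (@continuous_norm_powR p p0 (L n)) (FL n)).
Qed.

(** Extending the exponent by +oo to all a <= 0 makes the l^p norm a continuous
    function of the inverse exponent on the whole real line. *)
Definition exponent_of_inv (a : R) : \bar R := if a <= 0 then +oo%E else (a^-1)%:E.

Lemma exponent_of_inv_gt0 a : (0 < exponent_of_inv a)%E.
Proof.
by rewrite /exponent_of_inv; case: (ltP 0 a) => // a0; rewrite lte_fin invr_gt0.
Qed.

Lemma exponent_of_invV a : 0 <= a -> ((exponent_of_inv a)^-1 = a%:E)%E.
Proof.
rewrite /exponent_of_inv; case: (ltP 0 a) => [a0 _|a0 a0']; last first.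
  by rewrite invey; congr EFin; lra.
by rewrite inver invr_eq0 gt_eqF// invrK.
Qed.

Lemma exponent_of_inv_ge1 a : a <= 1 -> (1 <= exponent_of_inv a)%E.
Proof.
rewrite /exponent_of_inv; case: (ltP 0 a) => [a0 a1|_ _]; last exact: leey.
by rewrite lee_fin invf_ge1.
Qed.

Lemma exponent_of_inv_fine (s : \bar R) : (0 < s)%E -> exponent_of_inv (fine s^-1) = s.
Proof.
move=> s0; rewrite -[LHS]inveK.
by rewrite exponent_of_invV ?fine_inv_ge0// inv_fineK// inveK.
Qed.

(** When x is not zero: for a > 0 this is clear from the expression by expR and ln. For a <= 0 the
    norm is squeezed between the maximum M and N `^ (max a 0) * M, and both tend
    to M. *)
Lemma continuous_lp_norm_exponent (N : nat) (x : 'I_N -> R) :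
  continuous (fun a => lp_norm (exponent_of_inv a) x).
Proof.
set M := lp_norm +oo x.
have M0 : 0 <= M by exact: lp_norm_ge0.
have ub a : lp_norm (exponent_of_inv a) x <= N%:R `^ Num.max a 0 * M.
  have -> : Num.max a 0 = fine (exponent_of_inv a)^-1.
    rewrite /exponent_of_inv; case: (ltP 0 a) => [a0|a0]; last by rewrite invey.
    by rewrite inver invr_eq0 gt_eqF//= invrK.
  apply: lp_norm_le_max => [||n] //; first exact: exponent_of_inv_gt0.
  exact: (ler_norm_lp_norm _ _ (ltry 0)).
have lb a : M <= lp_norm (exponent_of_inv a) x.
  apply: bigmax_le => [|n _]; first exact: lp_norm_ge0.
  by apply: ler_norm_lp_norm; exact: exponent_of_inv_gt0.
have [ME|M_neq0] := eqVneq M 0.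
  suff -> : (fun a => lp_norm (exponent_of_inv a) x) = cst 0 by exact: cst_continuous.
  apply/funext => a; apply/eqP; rewrite eq_le lp_norm_ge0 andbT.
  by rewrite (le_trans (ub a))// ME mulr0.
have [n xn0] : exists n, x n != 0.
  apply/not_existsP => x0; move/eqP: M_neq0; apply; rewrite /M /=.
  apply/eqP; rewrite eq_le bigmax_ge_id andbT; apply: bigmax_le => // n _.
  by have /negP/negPn/eqP -> := x0 n; rewrite normr0.
have N0 : 0 < N%:R :> R by rewrite ltr0n (leq_trans _ (ltn_ord n)).
move=> a0; rewrite /continuous_at; have [a0_gt0|a0_le0] := ltP 0 a0; last first.
  have -> : lp_norm (exponent_of_inv a0) x = M by rewrite /exponent_of_inv a0_le0.
  apply: (@squeeze_cvgr _ (nbhs a0) _ R (cst M) (fun a => N%:R `^ Num.max a 0 * M)).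
  - by apply: nearW => a; rewrite lb ub.
  - exact: cvg_cst.
  - rewrite -[X in _ --> X]mul1r; apply: cvgM; last exact: cvg_cst.
    have -> : (fun a => N%:R `^ Num.max a 0) =
              (fun a => expR (Num.max a 0 * ln (N%:R : R))).
      by apply/funext => a; rewrite /powR gt_eqF.
    rewrite -[X in _ --> X]expR0 -[in X in _ --> X](mul0r (ln (N%:R : R))).
    apply: (@continuous_cvg _ _ _ _ _ _ (@expR R)); first exact: continuous_expR.
    apply: cvgM; last exact: cvg_cst.
    rewrite -[X in _ --> X](max_r a0_le0).
    by apply: (@continuous_max _ _ (fun a : R => a) (fun=> 0));
      [exact: cvg_id|exact: cvg_cst].
(* The zero entries are set apart: there powR is not given by expR and ln. *)
pose S (a : R) := \sum_(i < N) (if x i == 0 then 0 else expR (a^-1 * ln `|x i|)).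
have S_gt0 a : 0 < S a.
  rewrite /S (bigD1 n)//= (negbTE xn0) ltr_pwDl ?expR_gt0// sumr_ge0// => i _.
  by case: ifP => // _; exact: expR_ge0.
have SE a : 0 < a -> lp_norm (exponent_of_inv a) x = expR (a * ln (S a)).
  move=> a_gt0; rewrite /exponent_of_inv leNgt a_gt0/= invrK.
  have -> : \sum_i `|x i| `^ a^-1 = S a.
    apply: eq_bigr => i _; rewrite /powR normr_eq0.
    by case: eqVneq => // _; rewrite invr_eq0 gt_eqF.
  by rewrite /powR gt_eqF.
rewrite SE//.
have cS : (expR (a * ln (S a))) @[a --> a0] --> expR (a0 * ln (S a0)).
  apply: (@continuous_cvg _ _ _ _ _ _ (@expR R)); first exact: continuous_expR.
  apply: cvgM; first exact: cvg_id.
  apply: (@continuous_cvg _ _ _ _ _ S (@ln R)); first exact: continuous_ln.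
  apply: (cvg_big add_continuous) => i _.
  case: eqVneq => // _; first exact: cvg_cst.
  apply: (@continuous_cvg _ _ _ _ _ _ (@expR R)); first exact: continuous_expR.
  apply: cvgM; last exact: cvg_cst.
  by apply: cvgV => //; rewrite gt_eqF.
apply: cvg_trans cS; apply: near_eq_cvg.
by have := lt_nbhsr a0_gt0; apply: filterS => a a_gt0; rewrite SE.
Qed.

End Continuity.

(** * The minimum over the admissible exponents *)

Lemma admissible_exponent_of_inv (R : realType) (a b c : R) :
  0 <= a -> 0 <= b -> 0 <= c -> a + b + c = 1 ->
  admissible (exponent_of_inv a) (exponent_of_inv b) (exponent_of_inv c).
Proof.
move=> a0 b0 c0 abc.
by split; [apply: exponent_of_inv_ge1; lra|apply: exponent_of_inv_ge1; lra|
  apply: exponent_of_inv_ge1; lra|rewrite !exponent_of_invV// -!EFinD abc].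
Qed.

(** The simplex is a continuous image of the unit square. This reduces
    minimisation over the simplex to the square, whose compactness is immediate. *)
Lemma simplex_stick_breaking (R : realType) (a b c : R) :
  0 <= a -> 0 <= b -> 0 <= c -> a + b + c = 1 ->
  exists u v, [/\ 0 <= u <= 1, 0 <= v <= 1, a = u, b = (1 - u) * v &
    c = (1 - u) * (1 - v)].
Proof.
move=> a0 b0 c0 abc; have [a1|a_neq1] := eqVneq a 1.
  by exists a, 0; split => //; rewrite ?lexx ?ler01//; lra.
have a_lt1 : 0 < 1 - a by rewrite subr_gt0 lt_neqAle a_neq1/=; lra.
have bE : b = (1 - a) * (b / (1 - a)) by rewrite mulrCA mulfV ?gt_eqF// mulr1.
exists a, (b / (1 - a)); split => //.
- by apply/andP; split => //; lra.
- by rewrite divr_ge0 ?(ltW a_lt1)//= ler_pdivrMr// mul1r; lra.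
- by rewrite mulrBr mulr1 -bE; lra.
Qed.

(** The set is the image of the simplex of inverse exponents, hence of the unit
    square, under a continuous function. In the first factor the varying exponent
    is the inner one, so the continuity of the outer l^r norm in its vector is
    needed as well ([cvg_lp_norm]). *)
Lemma mixed_norm_min (R : realType) (k : scalar_kind) (N : nat)
    (U : 'M[scalar_field R k]_N) (r p' q' : \bar R) : (0 < r)%E ->
  exists m, is_least [set c | exists s t w : \bar R, admissible s t w /\
    c = mixed_norm (conj_transpose U) s r * mixed_norm U p' t * mixed_norm U q' w] m.
Proof.
move=> r0.
pose G (a b c : R) := mixed_norm (conj_transpose U) (exponent_of_inv a) r *
  mixed_norm U p' (exponent_of_inv b) * mixed_norm U q' (exponent_of_inv c).
pose F (uv : R * R) := G uv.1 ((1 - uv.1) * uv.2) ((1 - uv.1) * (1 - uv.2)).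
pose Q : set (R * R) := `[0, 1] `*` `[0, 1].
have cQ : compact Q by apply: compact_setX; exact: segment_compact.
have Q0 : Q !=set0 by exists (0, 0); rewrite /Q /=; split; rewrite in_itv/= lexx ler01.
have cF : continuous F.
  move=> uv.
  have c1 : (fun uv : R * R => uv.1) x @[x --> uv] --> uv.1 by exact: cvg_fst.
  have c2 : (fun uv : R * R => uv.2) x @[x --> uv] --> uv.2 by exact: cvg_snd.
  have c1' : (1 - x.1) @[x --> uv] --> 1 - uv.1 by apply: cvgB => //; exact: cvg_cst.
  have c2' : (1 - x.2) @[x --> uv] --> 1 - uv.2 by apply: cvgB => //; exact: cvg_cst.
  have lpc (y : 'I_N -> R) (g : R * R -> R) : g x @[x --> uv] --> g uv ->
      lp_norm (exponent_of_inv (g x)) y @[x --> uv] -->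
      lp_norm (exponent_of_inv (g uv)) y.
    move=> gc; apply: (@continuous_cvg _ _ _ _ _ g
      (fun a => lp_norm (exponent_of_inv a) y)) => //.
    exact: continuous_lp_norm_exponent.
  apply: cvgM; [apply: cvgM|].
  - by apply: cvg_lp_norm => // n; apply: lpc.
  - by apply: (lpc _ (fun x => (1 - x.1) * x.2)); exact: cvgM.
  - by apply: (lpc _ (fun x => (1 - x.1) * (1 - x.2))); exact: cvgM.
have [uv /set_mem [/= + +] Fmin] := compact_EVT_min Q0 cQ (continuous_subspaceT cF).
rewrite !in_itv/= => /andP[u0 u1] /andP[v0 v1].
exists (F uv); split.
  exists (exponent_of_inv uv.1), (exponent_of_inv ((1 - uv.1) * uv.2)),
    (exponent_of_inv ((1 - uv.1) * (1 - uv.2))).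
  split => //; apply: admissible_exponent_of_inv => //.
  - by rewrite mulr_ge0 ?subr_ge0.
  - by rewrite mulr_ge0 ?subr_ge0.
  - by ring.
move=> c [s [t [w [stwP ->]]]].
have [s0 t0 w0] := admissible_gt0 stwP; have [_ _ _ stw] := stwP.
have abc : fine s^-1 + fine t^-1 + fine w^-1 = 1.
  by apply: EFin_inj; rewrite !EFinD !inv_fineK.
have [u [v [u01 v01 sE tE wE]]] := simplex_stick_breaking
  (fine_inv_ge0 s0) (fine_inv_ge0 t0) (fine_inv_ge0 w0) abc.
rewrite -(exponent_of_inv_fine s0) -(exponent_of_inv_fine t0) -(exponent_of_inv_fine w0) sE tE wE.
by apply: (Fmin (u, v)); apply/mem_set; split; rewrite /= in_itv.
Qed.

(** * The bound, continuity and norm of the convolution *)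

Theorem theorem4p2 (R : realType) (k : scalar_kind) (N : nat) (N_ge1 : (1 <= N)%N)
    (u : 'I_N -> 'cV[scalar_field R k]_N) (u_onb : orthonormal_basis u)
    (X : completeNormedModType (scalar_field R k))
    (p q r p' q' : \bar R)
    (p_ge1 : (1 <= p)%E) (q_ge1 : (1 <= q)%E) (r_ge1 : (1 <= r)%E)
    (p'_ge1 : (1 <= p')%E) (q'_ge1 : (1 <= q')%E)
    (pp' : (p^-1 + p'^-1 = 1)%E) (qq' : (q^-1 + q'^-1 = 1)%E) :
  let U := basis_matrix u in
  let conv := @graph_conv R k N U X in
  [/\ forall s t w : \bar R, admissible s t w ->
        forall (alpha : 'I_N -> (scalar_field R k)^o) (f : 'I_N -> X),
          signal_norm r (conv alpha f) <=
            mixed_norm (conj_transpose U) s r * mixed_norm U p' t * mixed_norm U q' w *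
            signal_norm p alpha * signal_norm q f,
      bilinear_for *:%R *:%R conv,
      lp_continuous p q r conv
    & exists norm_conv min_const : R,
        [/\ is_least (bilinear_bounds p q r conv) norm_conv,
            is_least [set c | exists s t w : \bar R, admissible s t w /\
              c = mixed_norm (conj_transpose U) s r * mixed_norm U p' t *
                  mixed_norm U q' w] min_const
          & norm_conv <= min_const] ].
Proof.
have gt0 (s : \bar R) : (1 <= s)%E -> (0 < s)%E by exact: lt_le_trans.
move=> U conv.
have bound s t w (stw : admissible s t w) alpha (f : 'I_N -> X) :=
  graph_conv_bound U alpha f (gt0 _ p_ge1) (gt0 _ q_ge1) (gt0 _ r_ge1)
    (gt0 _ p'_ge1) (gt0 _ q'_ge1) pp' qq' stw.
have bil := graph_conv_bilinear U X.
have [m [[s [t [w [stw mE]]]] m_min]] := mixed_norm_min U p' q' (gt0 _ r_ge1).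
have m_bound : bilinear_bounds p q r conv m.
  by split => [|alpha f]; rewrite mE; [rewrite !mulr_ge0 ?lp_norm_ge0|exact: bound].
split => //.
- exact: bounded_bilinear_continuous (gt0 _ q_ge1) (gt0 _ r_ge1) bil m_bound.
- exists (inf (bilinear_bounds p q r conv)), m.
  have [inf_bound inf_min] := bilinear_bounds_least (ex_intro _ m m_bound).
  split => //; last exact: inf_min.
  by split => //; exists s, t, w.
Qed.
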